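(* Given a finite set of cells of the square grid, deciding whether it can be tiled by translated and rotated (not reflected) copies of the S-tetromino is solvable in polynomial time. Symmetrically, the same holds for the Z-tetromino.
   Context: With cells indexed by integer coordinates $(x,y)$, the S-tetromino is the set $\{(1,0),(2,0),(0,1),(1,1)\}$ and the Z-tetromino is its mirror image $\{(0,0),(1,0),(1,1),(2,1)\}$; each is allowed in all four rotations. A tiling must cover every given cell exactly once and cover no other cell. *)

(* Defs.v *)
From Stdlib Require Import ZArith List Arith.
Import ListNotations.

(** * Tilings of finite sets of cells *)

Definition cell : Type := (Z * Z)%type.

Definition cell_eq_dec (c d : cell) : {c = d} + {c <> d}.
Proof. decide equality; apply Z.eq_dec. Defined.

Definition S_tetromino : list cell := [(1, 0); (2, 0); (0, 1); (1, 1)]%Z.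
Definition Z_tetromino : list cell := [(0, 0); (1, 0); (1, 1); (2, 1)]%Z.

Definition quarter_turn (c : cell) : cell := (- snd c, fst c)%Z.
Definition translate (v c : cell) : cell := (fst v + fst c, snd v + snd c)%Z.

(** [(k, v)] stands for [k] quarter turns about the origin followed by the
    translation by [v]. *)
Definition placement : Type := (nat * cell)%type.

Definition placed (tile : list cell) (p : placement) : list cell :=
  map (fun c => translate (snd p) (Nat.iter (fst p) quarter_turn c)) tile.

(** The cells of a placed tile are distinct, so this counts the placements in
    [T] that contain [c]. *)
Definition cover_count (tile : list cell) (T : list placement) (c : cell) : nat :=
  count_occ cell_eq_dec (flat_map (placed tile) T) c.

Definition is_tiling (tile : list cell) (T : list placement) (A : list cell) : Prop :=
  (forall c, In c A -> cover_count tile T c = 1) /\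
  (forall c, ~ In c A -> cover_count tile T c = 0).

Definition tileable (tile : list cell) (A : list cell) : Prop :=
  exists T : list placement, is_tiling tile T A.

(** * Random access machines

    The accumulator RAM of Papadimitriou, _Computational Complexity_,
    Section 2.6: every instruction costs one step, and as there is no
    multiplication, polynomial time on this machine is polynomial time on
    Turing machines.  Register 0 is the accumulator.  The input is a read-only
    sequence of integers, indexed from 0, which reads as 0 past its end. *)

Inductive operand : Type :=
| Const (z : Z)
| Reg (j : nat)
| Ind (j : nat).    (* the register whose address is in register [j] *)

Inductive instr : Type :=
| READ (j : nat)
| READ_IND (j : nat)
| STORE (j : nat)
| STORE_IND (j : nat)
| LOAD (x : operand)
| ADD (x : operand)
| SUB (x : operand)
| HALF
| JUMP (l : nat)
| JPOS (l : nat)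
| JZERO (l : nat)
| JNEG (l : nat)
| HALT.

Definition program : Type := list instr.
Definition memory : Type := nat -> Z.

Definition upd (m : memory) (j : nat) (z : Z) : memory :=
  fun i => if Nat.eqb i j then z else m i.

(** A negative address is read as 0, through [Z.to_nat]. *)
Definition eval (m : memory) (x : operand) : Z :=
  match x with
  | Const z => z
  | Reg j => m j
  | Ind j => m (Z.to_nat (m j))
  end.

(** Next program counter and memory; [HALT] is treated in [run]. *)
Definition step (input : list Z) (i : instr) (pc : nat) (m : memory) : nat * memory :=
  match i with
  | READ j => (S pc, upd m 0 (nth j input 0%Z))
  | READ_IND j => (S pc, upd m 0 (nth (Z.to_nat (m j)) input 0%Z))
  | STORE j => (S pc, upd m j (m 0))
  | STORE_IND j => (S pc, upd m (Z.to_nat (m j)) (m 0))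
  | LOAD x => (S pc, upd m 0 (eval m x))
  | ADD x => (S pc, upd m 0 (Z.add (m 0) (eval m x)))
  | SUB x => (S pc, upd m 0 (Z.sub (m 0) (eval m x)))
  | HALF => (S pc, upd m 0 (Z.div (m 0) 2))
  | JUMP l => (l, m)
  | JPOS l => (if Z.ltb 0 (m 0) then l else S pc, m)
  | JZERO l => (if Z.eqb (m 0) 0 then l else S pc, m)
  | JNEG l => (if Z.ltb (m 0) 0 then l else S pc, m)
  | HALT => (pc, m)
  end.

(** Content of the accumulator if [HALT] is reached after at most [t] steps,
    [None] otherwise, and in particular if the program counter leaves [P]. *)
Fixpoint run (P : program) (input : list Z) (t : nat) (pc : nat) (m : memory)
  : option Z :=
  match nth_error P pc with
  | None => None
  | Some HALT => Some (m 0)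
  | Some i =>
      match t with
      | 0 => None
      | S t' => let (pc', m') := step input i pc m in run P input t' pc' m'
      end
  end.

Definition output_within (P : program) (input : list Z) (t : nat) (r : Z) : Prop :=
  run P input t 0 (fun _ => 0%Z) = Some r.

(** * Polynomial time *)

(** Number of symbols of the signed binary notation. *)
Definition bit_size (z : Z) : nat :=
  match z with
  | Z0 => 1
  | Zpos p => Pos.size_nat p
  | Zneg p => S (Pos.size_nat p)
  end.

Definition input_size (input : list Z) : nat := list_sum (map bit_size input).

Record decision_problem : Type := {
  instance : Type;
  encode : instance -> list Z;
  yes_instance : instance -> Prop
}.

Definition solvable_in_polynomial_time (D : decision_problem) : Prop :=
  exists (P : program) (a k : nat), forall x : instance D,
  exists r : Z,
    output_within P (encode D x) (a * input_size (encode D x) ^ k + a) r /\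
    (r = 1%Z \/ r = 0%Z) /\
    (r = 1%Z <-> yes_instance D x).

(** A finite set of cells is given by listing its elements, in any order and
    without repetition. *)
Definition cell_set : Type := {A : list cell | NoDup A}.

(** The number of cells, followed by their coordinates. *)
Definition encode_cells (A : cell_set) : list Z :=
  Z.of_nat (length (proj1_sig A))
    :: flat_map (fun c : cell => [fst c; snd c]) (proj1_sig A).

Definition tiling_problem (tile : list cell) : decision_problem :=
  {| instance := cell_set;
     encode := encode_cells;
     yes_instance := fun A => tileable tile (proj1_sig A) |}.

(* Main.v *)
From Stdlib Require Import ZArith List Arith Bool Lia Permutation.
Require Import Defs.
Import ListNotations.

(** A finite set has at most one tiling by the S-tetromino, and it is found
    greedily: let [b] be the leftmost cell of the lowest row.  Both pieces that
    can cover [b] have [b] as their own least cell.  If the right neighbour [r]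
    of [b] belongs to the set, the vertical piece at [b] would occupy the cells
    to the left of and above [r] so that no piece could cover [r]; otherwise the
    horizontal piece at [b] does not fit.  Hence the piece at [b] is forced, and
    removing it again and again takes quadratically many steps.  The
    Z-tetromino reduces to the S-tetromino by negating abscissas. *)

(** * Tilings by the S-tetromino *)

(** A half turn maps the tetromino to a translate of itself, so the four rotations leave two shapes,
    and indexing these by their least cell reduces the choice at [b] to one bit. Whether the forced
    piece fits needs no separate membership tests: the cells are distinct, so the piece lies in the
    set exactly when deleting its cells shortens the list by four. The obstacle is the machine: the
    algorithm has to be an explicit program with counted steps. Hence a small structured language is
    compiled to the machine, and every pass is a linear scan of an array, so that one loop rule
    serves for all scans. A round makes three scans, after which the array is four cells shorter or
    the search has failed. *)

(** The two orientations of the S-tetromino, listed from the leftmost cell [b]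
    of their lowest row; [o = true] is the horizontal one. *)
Definition piece (o : bool) (b : cell) : list cell :=
  let (x, y) := b in
  if o then [(x, y); (x + 1, y); (x - 1, y + 1); (x, y + 1)]%Z
  else [(x, y); (x, y + 1); (x + 1, y + 1); (x + 1, y + 2)]%Z.

Definition packed (Q : list (bool * cell)) : list cell :=
  flat_map (fun q => piece (fst q) (snd q)) Q.

(** For a duplicate-free [L], a single permutation says that the pieces are disjoint, stay inside
    [L] and exhaust it. *)
Definition packable (L : list cell) : Prop := exists Q, Permutation L (packed Q).

Definition flip (mir : bool) (c : cell) : cell :=
  if mir then (- fst c, snd c)%Z else c.

Definition tile_of (mir : bool) : list cell :=
  if mir then Z_tetromino else S_tetromino.

(** The conjugate of [quarter_turn] by [flip mir]: a reflection reverses the sense of rotation, so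
    the mirrored case uses the inverse quarter turn. *)
Definition turn (mir : bool) (c : cell) : cell :=
  if mir then (snd c, - fst c)%Z else quarter_turn c.

(** Turns the matching of two lists into an equation at a chosen index, so that [permute_cells] can
    match cells whose coordinates agree only up to [lia]. *)
Lemma permutation_pick {A : Type} (k : nat) (a : A) (l r : list A) :
  nth_error r k = Some a -> Permutation l (firstn k r ++ skipn (S k) r) ->
  Permutation (a :: l) r.
Proof.
  revert l r. induction k; intros l [|b r]; simpl; try discriminate.
  - intros [= ->] H. now constructor.
  - intros Hk Hl. rewrite Hl, perm_swap. constructor. now apply IHk.
Qed.

Ltac permute_cells :=
  cbn; unfold translate, quarter_turn; cbn;
  repeat first
    [ apply perm_nil
    | eapply (permutation_pick 0); [cbn; f_equal; f_equal; lia | cbn]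
    | eapply (permutation_pick 1); [cbn; f_equal; f_equal; lia | cbn]
    | eapply (permutation_pick 2); [cbn; f_equal; f_equal; lia | cbn]
    | eapply (permutation_pick 3); [cbn; f_equal; f_equal; lia | cbn] ].

Lemma turn_piece mir o b : exists o' b',
  Permutation (map (turn mir) (piece o b)) (piece o' b').
Proof.
  exists (negb o).
  destruct b as [x y], o, mir;
    (* A quarter turn exchanges the orientations; the new anchor is the image of the cell that
       becomes the least one. *)
    [ exists (y, - x - 1)%Z | exists (- y - 1, x - 1)%Z
    | exists (y + 1, - x - 1)%Z | exists (- y - 1, x)%Z ]; permute_cells.
Qed.

Lemma translate_piece v o b :
  map (translate v) (piece o b) = piece o (translate v b).
Proof.
  destruct v, b, o; cbn; unfold translate; cbn; repeat (f_equal; try lia).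
Qed.

Lemma flip_placement mir v k c :
  flip mir (translate v (Nat.iter k quarter_turn c)) =
  translate (flip mir v) (Nat.iter k (turn mir) (flip mir c)).
Proof.
  assert (Ht : forall d, flip mir (translate v d) =
                         translate (flip mir v) (flip mir d)).
  { intros d. destruct mir; cbn; auto. unfold translate; cbn. f_equal; lia. }
  rewrite Ht. f_equal. induction k; [reflexivity|]. rewrite !Nat.iter_succ, <- IHk.
  destruct mir; unfold turn, quarter_turn; cbn; f_equal; lia.
Qed.

Lemma flip_placed mir p : exists o b,
  Permutation (map (flip mir) (placed (tile_of mir) p)) (piece o b).
Proof.
  destruct p as [k v].
  assert (H : exists o b, Permutation
    (map (fun c => Nat.iter k (turn mir) (flip mir c)) (tile_of mir)) (piece o b)).
  { induction k as [|k (o & b & IH)].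
    (* The least cell of the unrotated tile, after mirroring in the case of the Z-tetromino. *)
    - exists true, (if mir then (-1, 0) else (1, 0))%Z. destruct mir; permute_cells.
    - destruct (turn_piece mir o b) as (o' & b' & H). exists o', b'.
      rewrite <- H, <- IH, map_map. reflexivity. }
  destruct H as (o & b & H). exists o, (translate (flip mir v) b).
  rewrite <- translate_piece, <- H. unfold placed. rewrite !map_map. cbn.
  erewrite map_ext; [reflexivity|]. intros c. apply flip_placement.
Qed.

Lemma piece_flip_placed mir o b : exists p,
  Permutation (map (flip mir) (placed (tile_of mir) p)) (piece o b).
Proof.
  destruct b as [x y].
  destruct mir, o;
    (* Zero turns give the horizontal shape and one turn the vertical shape; the translation moves
       the least cell to [(x, y)] after the flip. *)
    [ exists (0, (- x - 1, y)%Z) | exists (1, (- x, y)%Z)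
    | exists (0, (x - 1, y)%Z) | exists (1, (x + 1, y)%Z) ]; permute_cells.
Qed.

Lemma flip_involutive mir c : flip mir (flip mir c) = c.
Proof. destruct mir, c; cbn; auto. f_equal; lia. Qed.

Lemma count_occ_flip mir l c :
  count_occ cell_eq_dec (map (flip mir) l) (flip mir c) = count_occ cell_eq_dec l c.
Proof.
  symmetry. apply count_occ_map. intros a b H.
  now rewrite <- (flip_involutive mir a), H, flip_involutive.
Qed.

(** [NoDup A] makes every multiplicity in [A] 0 or 1, so the two covering clauses together state
    equality of occurrence counts. *)
Lemma is_tiling_permutation tile T A : NoDup A ->
  is_tiling tile T A <-> Permutation A (flat_map (placed tile) T).
Proof.
  intros HA. rewrite (Permutation_count_occ cell_eq_dec).
  pose proof (proj1 (NoDup_count_occ' cell_eq_dec A) HA) as H1.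
  split.
  - intros [Hin Hout] c. destruct (in_dec cell_eq_dec c A) as [Hc|Hc].
    + rewrite H1 by assumption. symmetry. now apply Hin.
    + rewrite (proj1 (count_occ_not_In cell_eq_dec A c) Hc). symmetry. now apply Hout.
  - intros H. split; intros c Hc; unfold cover_count; rewrite <- H.
    + now apply H1.
    + now apply count_occ_not_In.
Qed.

Lemma tileable_packable mir A : NoDup A ->
  tileable (tile_of mir) A <-> packable (map (flip mir) A).
Proof.
  intros HA. split.
  - intros [T HT]. apply is_tiling_permutation in HT; [|assumption].
    assert (H : exists Q, Permutation
      (map (flip mir) (flat_map (placed (tile_of mir)) T)) (packed Q)).
    { clear HT. induction T as [|p T [Q IH]]; [now exists []|].
      destruct (flip_placed mir p) as (o & b & Hp). exists ((o, b) :: Q).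
      cbn [flat_map packed]. rewrite map_app. now apply Permutation_app. }
    destruct H as [Q H]. exists Q. now rewrite HT.
  - intros [Q HQ].
    assert (H : exists T, Permutation
      (map (flip mir) (flat_map (placed (tile_of mir)) T)) (packed Q)).
    { clear HQ. induction Q as [|[o b] Q [T IH]]; [now exists []|].
      destruct (piece_flip_placed mir o b) as (p & Hp). exists (p :: T).
      cbn [flat_map packed]. rewrite map_app. now apply Permutation_app. }
    destruct H as [T H]. exists T. apply is_tiling_permutation; [assumption|].
    rewrite <- H in HQ. apply (Permutation_map (flip mir)) in HQ.
    rewrite !map_map in HQ.
    rewrite !(map_ext _ (fun c => c) (flip_involutive mir)), !map_id in HQ.
    assumption.
Qed.

(** * The forced piece *)

Definition lex_le (b c : cell) : Prop :=
  (snd b < snd c \/ (snd b = snd c /\ fst b <= fst c))%Z.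

Definition right_of (b : cell) : cell := (fst b + 1, snd b)%Z.

Definition outside (o : bool) (b c : cell) : bool :=
  if in_dec cell_eq_dec c (piece o b) then false else true.

Lemma lex_le_piece o b c : In c (piece o b) -> lex_le b c.
Proof.
  destruct b as [x y], o; cbn; unfold lex_le; intuition (subst; cbn; lia).
Qed.

Lemma filter_outside_app o b R :
  NoDup (piece o b ++ R) -> filter (outside o b) (piece o b ++ R) = R.
Proof.
  intros H. rewrite filter_app.
  assert (E : forall l, incl l (piece o b) -> filter (outside o b) l = []).
  { induction l as [|c l IH]; intros Hl; cbn; auto. unfold outside at 1.
    destruct in_dec as [_|n].
    - apply IH. intros d Hd. apply Hl. now right.
    - destruct n. apply Hl. now left. }
  rewrite E by apply incl_refl. cbn.
  assert (D : forall c, In c R -> ~ In c (piece o b)).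
  { intros c Hc Hp. destruct (in_split _ _ Hc) as (R1 & R2 & ->).
    rewrite app_assoc in H. apply NoDup_remove_2 in H. apply H.
    rewrite <- app_assoc. apply in_or_app. now left. }
  clear H E. induction R as [|c R IH]; cbn; auto. unfold outside at 1.
  destruct in_dec as [i|_].
  - destruct (D c); [now left | assumption].
  - f_equal. apply IH. intros d Hd. apply D. now right.
Qed.

Lemma piece_length o b : length (piece o b) = 4.
Proof. now destruct b, o. Qed.

(** The deleted cells form a duplicate-free list inside [piece o b], so a loss of exactly four means
    that the whole piece was in [L]. *)
Lemma Permutation_filter_outside o b L : NoDup L ->
  length (filter (outside o b) L) + 4 = length L ->
  Permutation L (piece o b ++ filter (outside o b) L).
Proof.
  intros HL Hlen.
  pose proof (filter_length (outside o b) L) as Hf.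
  assert (HP : Permutation (filter (fun c => negb (outside o b c)) L) (piece o b)).
  { apply NoDup_Permutation_bis.
    - now apply NoDup_filter.
    - rewrite piece_length. lia.
    - intros c Hc. apply filter_In in Hc as [_ Hc]. unfold outside in Hc.
      now destruct in_dec in Hc. }
  rewrite <- HP. clear. induction L as [|c L IH]; cbn; auto.
  destruct (outside o b c); cbn; [now apply Permutation_cons_app | now constructor].
Qed.

Lemma orientation_forced o b Q : NoDup (packed ((o, b) :: Q)) ->
  (forall c, In c (packed ((o, b) :: Q)) -> lex_le b c) ->
  (In (right_of b) (packed ((o, b) :: Q)) <-> o = true).
Proof.
  intros HN Hmin. split.
  - intros Hr. destruct o; [reflexivity|exfalso].
    destruct b as [x y]. unfold right_of in Hr. cbn [fst snd] in Hr.
    cbn [packed flat_map fst snd] in Hr. apply in_app_or in Hr as [Hr|Hr].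
    { cbn in Hr. repeat destruct Hr as [Hr|Hr]; try contradiction; injection Hr; lia. }
    apply in_flat_map in Hr as ([o2 b2] & Hq & Hc). cbn [fst snd] in Hc.
    assert (HR : forall c, In c (piece o2 b2) -> ~ In c (piece false (x, y))).
    { intros c Hc2 Hc1. cbn [packed flat_map fst snd] in HN.
      assert (Hf : In c (packed Q)) by (apply in_flat_map; now exists (o2, b2)).
      destruct (in_split _ _ Hf) as (R1 & R2 & E). unfold packed in E.
      rewrite E, app_assoc in HN.
      apply NoDup_remove_2 in HN. apply HN. rewrite <- app_assoc.
      apply in_or_app. now left. }
    assert (Hb : lex_le (x, y) b2).
    { apply Hmin. cbn [packed flat_map]. apply in_or_app. right.
      apply in_flat_map. exists (o2, b2). split; auto. destruct b2, o2; now left. }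
    destruct b2 as [x2 y2]. unfold lex_le in Hb. cbn in Hb.
    (* Of the eight ways in which a piece can contain the right neighbour, five have their anchor in
       a row below [b], against [Hb]. The other three share a cell with the vertical piece at
       [(x, y)], exhibited below. *)
    destruct o2; cbn in Hc;
      repeat destruct Hc as [Hc|Hc]; try contradiction; injection Hc as E1 E2; try lia.
    + apply (HR (x, y + 1)%Z); [|cbn; auto].
      cbn. right. right. left. f_equal; lia.
    + apply (HR (x, y)); [|cbn; auto]. cbn. left. f_equal; lia.
    + apply (HR (x + 1, y + 1)%Z); [|cbn; auto]. cbn. right. left. f_equal; lia.
  - intros ->. destruct b as [x y]. cbn. auto.
Qed.

Lemma Permutation_filter {A : Type} (f : A -> bool) (l l' : list A) :
  Permutation l l' -> Permutation (filter f l) (filter f l').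
Proof.
  intros H. induction H; cbn.
  - constructor.
  - destruct (f x); auto.
  - destruct (f x), (f y); auto using perm_swap.
  - now transitivity (filter f l').
Qed.

(** Being an equivalence, it serves both outcomes of a round: an incomplete removal refutes
    packability, with no backtracking. *)
Lemma packable_step L b o : NoDup L -> In b L ->
  (forall c, In c L -> lex_le b c) -> (o = true <-> In (right_of b) L) ->
  packable L <->
  length (filter (outside o b) L) + 4 = length L /\ packable (filter (outside o b) L).
Proof.
  intros HL Hb Hmin Ho. split.
  - intros [Q HQ].
    assert (Hb' := Permutation_in _ HQ Hb).
    apply in_flat_map in Hb' as ([o' b'] & Hq & Hb'). cbn [fst snd] in Hb'.
    destruct (in_split _ _ Hq) as (Q1 & Q2 & E).
    assert (HP : Permutation L (packed ((o', b') :: Q1 ++ Q2))).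
    { rewrite HQ, E. apply Permutation_flat_map. symmetry. apply Permutation_middle. }
    (* The anchor [b'] lies in [L], hence not before [b]; and [b] lies in the piece at [b'], hence
       not before [b']. *)
    assert (Heq : b' = b).
    { assert (Hb'' : In b' L).
      { apply (Permutation_in _ (Permutation_sym HP)). cbn [packed flat_map].
        apply in_or_app. left. destruct b', o'; now left. }
      apply Hmin in Hb''. apply lex_le_piece in Hb'. unfold lex_le in *.
      destruct b, b'; cbn in *. f_equal; lia. }
    subst b'.
    assert (Ho' : o' = o).
    { pose proof (orientation_forced o' b (Q1 ++ Q2)
        (Permutation_NoDup HP HL)) as F.
      assert (Hi : In (right_of b) L <-> o' = true).
      { rewrite <- F.
        - split; apply Permutation_in; [|symmetry]; exact HP.
        - intros c Hc. apply Hmin. now apply (Permutation_in _ (Permutation_sym HP)). }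
      destruct o, o'; intuition congruence. }
    subst o'. cbn [packed flat_map fst snd] in HP.
    assert (HF : Permutation (filter (outside o b) L) (packed (Q1 ++ Q2))).
    { rewrite <- (filter_outside_app o b (packed (Q1 ++ Q2))).
      - now apply Permutation_filter.
      - exact (Permutation_NoDup HP HL). }
    split.
    + apply Permutation_length in HP, HF. rewrite length_app, piece_length in HP.
      unfold packed in HF. lia.
    + now exists (Q1 ++ Q2).
  - intros [Hlen [Q HQ]]. exists ((o, b) :: Q).
    rewrite (Permutation_filter_outside o b L HL Hlen). cbn [packed flat_map fst snd].
    now apply Permutation_app_head.
Qed.

(** * Structured programs on the random access machine *)

Inductive sign_test : Type := TPos | TZero | TNeg.

Definition jump_if (t : sign_test) (l : nat) : instr :=
  match t with TPos => JPOS l | TZero => JZERO l | TNeg => JNEG l end.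

Definition passes (t : sign_test) (z : Z) : bool :=
  match t with TPos => Z.ltb 0 z | TZero => Z.eqb z 0 | TNeg => Z.ltb z 0 end.

Definition is_straight (i : instr) : bool :=
  match i with
  | JUMP _ | JPOS _ | JZERO _ | JNEG _ | HALT => false
  | _ => true
  end.

(** [If] and [While] test the accumulator; [While t g c] runs the guard code
    [g] before each test. *)
Inductive com : Type :=
| Block (l : list instr)
| Seq (c1 c2 : com)
| If (t : sign_test) (c1 c2 : com)
| While (t : sign_test) (g c : com).

Fixpoint code_size (c : com) : nat :=
  match c with
  | Block l => length l
  | Seq c1 c2 => code_size c1 + code_size c2
  | If _ c1 c2 => code_size c1 + code_size c2 + 2
  | While _ g c => code_size g + code_size c + 3
  end.

(** Jump targets are absolute, hence the start address [off]. As a conditional jump is taken when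
    the test passes, the else branch comes first, and a passing loop guard jumps over the exit
    jump. *)
Fixpoint compile (off : nat) (c : com) : list instr :=
  match c with
  | Block l => l
  | Seq c1 c2 => compile off c1 ++ compile (off + code_size c1) c2
  | If t c1 c2 =>
      let l1 := off + 2 + code_size c2 in
      jump_if t l1 :: compile (off + 1) c2
        ++ JUMP (l1 + code_size c1) :: compile l1 c1
  | While t g c =>
      let l1 := off + code_size g in
      compile off g ++ jump_if t (l1 + 2) :: JUMP (l1 + 3 + code_size c)
        :: compile (l1 + 2) c ++ [JUMP off]
  end.

Lemma length_compile c off : length (compile off c) = code_size c.
Proof.
  revert off. induction c; intros off; cbn; auto;
    rewrite ?length_app; cbn; rewrite ?length_app, ?IHc1, ?IHc2; cbn; lia.
Qed.

(** * Timed semantics and correctness of compilation *)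

Definition effect (input : list Z) (m : memory) (i : instr) : memory :=
  snd (step input i 0 m).

(** The extra summands count the jumps of the compiled code: a test for each branching, a jump past
    the then branch, a jump back after each round of a loop, and the exit jump. *)
Inductive exec (input : list Z) : com -> memory -> memory -> nat -> Prop :=
| exec_block l m : forallb is_straight l = true ->
    exec input (Block l) m (fold_left (effect input) l m) (length l)
| exec_seq c1 c2 m1 m2 m3 t1 t2 :
    exec input c1 m1 m2 t1 -> exec input c2 m2 m3 t2 ->
    exec input (Seq c1 c2) m1 m3 (t1 + t2)
| exec_if_true t c1 c2 m m' n : passes t (m 0) = true ->
    exec input c1 m m' n -> exec input (If t c1 c2) m m' (1 + n)
| exec_if_false t c1 c2 m m' n : passes t (m 0) = false ->
    exec input c2 m m' n -> exec input (If t c1 c2) m m' (1 + (n + 1))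
| exec_while_true t g c m m1 m2 m3 n1 n2 n3 :
    exec input g m m1 n1 -> passes t (m1 0) = true ->
    exec input c m1 m2 n2 -> exec input (While t g c) m2 m3 n3 ->
    exec input (While t g c) m m3 (n1 + (1 + (n2 + (1 + n3))))
| exec_while_false t g c m m1 n1 :
    exec input g m m1 n1 -> passes t (m1 0) = false ->
    exec input (While t g c) m m1 (n1 + (1 + 1)).

(** Quantifying over the remaining fuel [k] lets segments be chained by adding their step counts. *)
Definition runs (P : program) (input : list Z) (pc : nat) (m : memory)
    (pc' : nat) (m' : memory) (n : nat) : Prop :=
  forall k, run P input (n + k) pc m = run P input k pc' m'.

Lemma runs_trans P input pc1 m1 pc2 m2 pc3 m3 n1 n2 :
  runs P input pc1 m1 pc2 m2 n1 -> runs P input pc2 m2 pc3 m3 n2 ->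
  runs P input pc1 m1 pc3 m3 (n1 + n2).
Proof. intros H1 H2 k. now rewrite <- Nat.add_assoc, H1, H2. Qed.

Lemma runs_step P input pc m i : nth_error P pc = Some i -> i <> HALT ->
  runs P input pc m (fst (step input i pc m)) (snd (step input i pc m)) 1.
Proof.
  intros Hi Hh k. cbn [Nat.add run]. rewrite Hi.
  destruct i; try reflexivity. now destruct Hh.
Qed.

Definition located (P : program) (off : nat) (l : list instr) : Prop :=
  forall i, i < length l -> nth_error P (off + i) = nth_error l i.

Lemma located_app P off l1 l2 : located P off (l1 ++ l2) ->
  located P off l1 /\ located P (off + length l1) l2.
Proof.
  intros H. split; intros i Hi.
  - rewrite H by (rewrite length_app; lia). now apply nth_error_app1.
  - rewrite <- Nat.add_assoc, H by (rewrite length_app; lia).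
    rewrite nth_error_app2 by lia. f_equal. lia.
Qed.

Lemma located_cons P off i l : located P off (i :: l) ->
  nth_error P off = Some i /\ located P (off + 1) l.
Proof.
  intros H. split.
  - specialize (H 0). rewrite Nat.add_0_r in H. rewrite H; cbn; [reflexivity|lia].
  - now apply (located_app P off [i] l) in H.
Qed.

Lemma runs_jump_if P input t l pc m : nth_error P pc = Some (jump_if t l) ->
  runs P input pc m (if passes t (m 0) then l else pc + 1) m 1.
Proof.
  intros H. rewrite Nat.add_1_r.
  assert (Hn : jump_if t l <> HALT) by (destruct t; discriminate).
  pose proof (runs_step P input pc m _ H Hn) as R. destruct t; exact R.
Qed.

Lemma runs_jump P input l pc m : nth_error P pc = Some (JUMP l) ->
  runs P input pc m l m 1.
Proof. intros H. apply (runs_step P input pc m (JUMP l) H). discriminate. Qed.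

(** The induction is on the derivation and not on [c], since the remaining rounds of a loop execute
    the same [While] at the same address. *)
Lemma runs_compile P input c m m' n : exec input c m m' n ->
  forall off, located P off (compile off c) ->
  runs P input off m (off + code_size c) m' n.
Proof.
  intros H. induction H; intros off L; cbn [compile code_size] in *.
  - revert off m L. induction l as [|i l IH]; intros off m L; cbn in *.
    + rewrite Nat.add_0_r. now intros k.
    + apply andb_prop in H as [Hi Hl]. apply located_cons in L as [L1 L2].
      change (S (length l)) with (1 + length l). rewrite Nat.add_assoc.
      eapply runs_trans; [|apply IH; assumption].
      rewrite Nat.add_1_r. unfold effect.
      pose proof (runs_step P input off m i L1) as R.
      destruct i; try discriminate; apply R; discriminate.
  - apply located_app in L as [L1 L2]. rewrite length_compile in L2.
    rewrite Nat.add_assoc. eapply runs_trans; eauto.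
  - apply located_cons in L as [L1 L2]. apply located_app in L2 as [L2 L3].
    apply located_cons in L3 as [_ L3]. rewrite length_compile in L3.
    eapply runs_trans; [eapply runs_jump_if; eassumption|]. rewrite H.
    replace (off + 1 + code_size c2 + 1) with (off + 2 + code_size c2) in L3 by lia.
    replace (off + (code_size c1 + code_size c2 + 2))
      with (off + 2 + code_size c2 + code_size c1) by lia. auto.
  - apply located_cons in L as [L1 L2]. apply located_app in L2 as [L2 L3].
    apply located_cons in L3 as [L3 _]. rewrite length_compile in L3.
    eapply runs_trans; [eapply runs_jump_if; eassumption|]. rewrite H.
    eapply runs_trans; [apply IHexec; assumption|].
    replace (off + (code_size c1 + code_size c2 + 2))
      with (off + 2 + code_size c2 + code_size c1) by lia.
    now apply runs_jump.
  - pose proof L as L'.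
    apply located_app in L as [L1 L2]. rewrite length_compile in L2.
    apply located_cons in L2 as [L2 L3]. apply located_cons in L3 as [L3 L4].
    apply located_app in L4 as [L4 L5]. apply located_cons in L5 as [L5 _].
    rewrite length_compile in L5.
    eapply runs_trans; [apply IHexec1; assumption|].
    eapply runs_trans; [eapply runs_jump_if; eassumption|]. rewrite H0.
    replace (off + code_size g + 1 + 1) with (off + code_size g + 2) in * by lia.
    eapply runs_trans; [apply IHexec2; assumption|].
    eapply runs_trans; [apply runs_jump; eassumption|]. now apply IHexec3.
  - apply located_app in L as [L1 L2]. rewrite length_compile in L2.
    apply located_cons in L2 as [L2 L3]. apply located_cons in L3 as [L3 _].
    eapply runs_trans; [apply IHexec; assumption|].
    eapply runs_trans; [eapply runs_jump_if; eassumption|]. rewrite H0.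
    replace (off + (code_size g + code_size c + 3))
      with (off + code_size g + 3 + code_size c) by lia.
    now apply runs_jump.
Qed.

Lemma exec_output_within c input m n T : exec input c (fun _ => 0%Z) m n -> n <= T ->
  output_within (compile 0 c ++ [HALT]) input T (m 0).
Proof.
  intros H HT. unfold output_within.
  assert (L : located (compile 0 c ++ [HALT]) 0 (compile 0 c)).
  { intros i Hi. cbn. now apply nth_error_app1. }
  pose proof (runs_compile _ input c _ _ n H 0 L (T - n)) as R.
  replace (n + (T - n)) with T in R by lia. rewrite R.
  assert (E : nth_error (compile 0 c ++ [HALT]) (0 + code_size c) = Some HALT).
  { rewrite nth_error_app2; rewrite length_compile; [|lia]. cbn.
    now rewrite Nat.sub_diag. }
  (* [run] recognizes [HALT] before it inspects the fuel, so no fuel need be left over. *)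
  destruct (T - n); cbn [run]; now rewrite E.
Qed.

(** * Total correctness with time bounds *)

Definition achieves (input : list Z) (c : com) (m : memory) (T : nat)
    (Q : memory -> Prop) : Prop :=
  exists m' n, exec input c m m' n /\ n <= T /\ Q m'.

Lemma achieves_seq input c1 c2 m T1 T2 (Q1 Q2 : memory -> Prop) :
  achieves input c1 m T1 Q1 -> (forall m1, Q1 m1 -> achieves input c2 m1 T2 Q2) ->
  achieves input (Seq c1 c2) m (T1 + T2) Q2.
Proof.
  intros (m1 & n1 & E1 & H1 & HQ1) H.
  destruct (H m1 HQ1) as (m2 & n2 & E2 & H2 & HQ2).
  exists m2, (n1 + n2). repeat split; auto; [econstructor; eauto | lia].
Qed.

Lemma achieves_weaken input c m T T' (Q Q' : memory -> Prop) :
  achieves input c m T Q -> T <= T' -> (forall m', Q m' -> Q' m') ->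
  achieves input c m T' Q'.
Proof.
  intros (m1 & n1 & E1 & H1 & HQ1) H HQ. exists m1, n1. repeat split; auto; lia.
Qed.

(** Weakest precondition and worst-case time, for loop-free programs only. *)
Fixpoint wp (input : list Z) (c : com) (Q : memory -> Prop) (m : memory) : Prop :=
  match c with
  | Block l => forallb is_straight l = true /\ Q (fold_left (effect input) l m)
  | Seq c1 c2 => wp input c1 (wp input c2 Q) m
  | If t c1 c2 => if passes t (m 0) then wp input c1 Q m else wp input c2 Q m
  | While _ _ _ => False
  end.

Fixpoint cost (c : com) : nat :=
  match c with
  | Block l => length l
  | Seq c1 c2 => cost c1 + cost c2
  | If _ c1 c2 => cost c1 + cost c2 + 2
  | While _ _ _ => 0
  end.

Lemma wp_achieves input c (Q : memory -> Prop) m :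
  wp input c Q m -> achieves input c m (cost c) Q.
Proof.
  revert Q m. induction c; intros Q m H; cbn [wp cost] in *.
  - destruct H as [Hl HQ]. eexists _, _. repeat split; eauto. now constructor.
  - eapply achieves_seq; eauto.
  - destruct (passes t (m 0)) eqn:E.
    + destruct (IHc1 _ _ H) as (m' & n & He & Hn & HQ).
      eexists _, _. split; [now apply exec_if_true; eauto|]. split; auto. lia.
    + destruct (IHc2 _ _ H) as (m' & n & He & Hn & HQ).
      eexists _, _. split; [now apply exec_if_false; eauto|]. split; auto. lia.
  - contradiction.
Qed.

Lemma wp_mono input c (Q Q' : memory -> Prop) m :
  (forall m', Q m' -> Q' m') -> wp input c Q m -> wp input c Q' m.
Proof.
  intros HQ. revert Q Q' m HQ. induction c; intros Q Q' m HQ; cbn.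
  - intuition.
  - apply IHc1. intros m'. now apply IHc2.
  - destruct passes; eauto.
  - auto.
Qed.

(** The invariant splits the list into a processed part and a remaining part, which is also the
    termination measure. Each round pays 2 for the test and the jump back; the extra round pays for
    the final guard and the exit. *)
Lemma achieves_scan {A : Type} input t g c (I : list A -> list A -> memory -> Prop) :
  (forall d a r m, I d (a :: r) m ->
    wp input g (fun m1 => passes t (m1 0) = true /\
                          wp input c (I (d ++ [a]) r) m1) m) ->
  (forall d m, I d [] m ->
    wp input g (fun m1 => passes t (m1 0) = false /\ I d [] m1) m) ->
  forall l m, I [] l m ->
  achieves input (While t g c) m ((cost g + cost c + 2) * (length l + 1)) (I l []).
Proof.
  intros Hstep Hend.
  assert (H : forall r d m, I d r m -> achieves input (While t g c) m
    ((cost g + cost c + 2) * (length r + 1)) (I (d ++ r) [])).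
  { induction r as [|a r IH]; intros d m HI.
    - destruct (wp_achieves _ _ _ _ (Hend d m HI)) as (m1 & n & E & Hn & Ht & HI1).
      exists m1, (n + (1 + 1)). rewrite app_nil_r. repeat split; auto.
      + now constructor.
      + cbn. lia.
    - destruct (wp_achieves _ _ _ _ (Hstep d a r m HI)) as (m1 & n & E & Hn & Ht & H1).
      destruct (wp_achieves _ _ _ _ H1) as (m2 & n2 & E2 & Hn2 & HI2).
      destruct (IH _ _ HI2) as (m3 & n3 & E3 & Hn3 & HI3).
      rewrite <- app_assoc in HI3.
      exists m3. eexists. split; [now eapply exec_while_true; eauto|].
      split; [|assumption]. cbn [length]. lia. }
  intros l m. apply H.
Qed.

(** * Lists of cells in memory *)

Fixpoint cells_at (m : memory) (a : nat) (L : list cell) : Prop :=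
  match L with
  | [] => True
  | c :: L' => m a = fst c /\ m (S a) = snd c /\ cells_at m (S (S a)) L'
  end.

Lemma cells_at_app m a L1 L2 :
  cells_at m a (L1 ++ L2) <-> cells_at m a L1 /\ cells_at m (a + 2 * length L1) L2.
Proof.
  revert a. induction L1 as [|c L1 IH]; intros a.
  - cbn [app length cells_at]. replace (a + 2 * 0) with a by lia. tauto.
  - cbn [app length cells_at]. rewrite IH.
    replace (a + 2 * S (length L1)) with (S (S a) + 2 * length L1) by lia. tauto.
Qed.

Lemma cells_at_ext m m' a L :
  (forall k, a <= k < a + 2 * length L -> m' k = m k) ->
  cells_at m a L -> cells_at m' a L.
Proof.
  revert a. induction L as [|c L IH]; intros a H; [auto|].
  cbn [length cells_at] in *. rewrite !H by lia.
  intros (H1 & H2 & H3). repeat split; auto. apply IH; auto. intros k Hk. apply H. lia.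
Qed.

(** The input is viewed as a memory, so that one predicate describes cells in the input and in
    registers. The arbitrary prefix carries the induction. *)
Lemma cells_at_input pre L :
  cells_at (fun i => nth i (pre ++ flat_map (fun c : cell => [fst c; snd c]) L) 0%Z)
    (length pre) L.
Proof.
  revert pre. induction L as [|c L IH]; intros pre; cbn [cells_at flat_map]; auto.
  split; [|split].
  - rewrite app_nth2, Nat.sub_diag by lia. reflexivity.
  - rewrite app_nth2 by lia. now replace (S (length pre) - length pre) with 1 by lia.
  - specialize (IH (pre ++ [fst c; snd c])). rewrite length_app in IH.
    replace (S (S (length pre))) with (length pre + length [fst c; snd c]) by (cbn; lia).
    rewrite <- app_assoc in IH. exact IH.
Qed.

(** * The program

    The cells still to be covered are stored in pairs of registers from
    register 20 up to the address held by register 1, excluded.  Register 2 is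
    the scan pointer, 3 the write pointer, 4 and 5 hold the lexicographically
    least cell [b]; 6 and 7 the scanned cell, 11 and 12 its position relative
    to [b]; 8 is 0 if [b] must be covered horizontally and 1 otherwise. *)

Definition advance (j : nat) : list instr := [LOAD (Reg j); ADD (Const 1); STORE j].

Definition scanning : com := Block [LOAD (Reg 1); SUB (Reg 2)].

Definition fetch : com :=
  Block ([LOAD (Ind 2); STORE 6] ++ advance 2 ++ [LOAD (Ind 2); STORE 7] ++ advance 2
    ++ [LOAD (Reg 6); SUB (Reg 4); STORE 11; LOAD (Reg 7); SUB (Reg 5); STORE 12]).

Definition skip : com := Block [].

Definition push (j : nat) : com := Block (STORE_IND j :: advance j).

Definition mark (x y : operand) (j : nat) (z : Z) : com :=
  Seq (Block [LOAD (Reg 11); SUB x])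
    (If TZero
       (Seq (Block [LOAD (Reg 12); SUB y])
          (If TZero (Block [LOAD (Const z); STORE j]) skip))
       skip).

(** Storing the abscissa and subtracting it twice negates it, so the reflection is done while
    copying. Register 3 counts the cells still to be read. *)
Definition load_input (mir : bool) : com :=
  Seq (Block [LOAD (Const 20); STORE 1; LOAD (Const 1); STORE 2; READ 0; STORE 3])
    (While TPos (Block [LOAD (Reg 3)])
      (Seq (Block (READ_IND 2 :: if mir then [STORE 4; SUB (Reg 4); SUB (Reg 4)] else []))
        (Seq (push 1)
          (Seq (Block (advance 2 ++ [READ_IND 2]))
            (Seq (push 1)
              (Block (advance 2 ++ [LOAD (Reg 3); SUB (Const 1); STORE 3]))))))).

Definition find_least : com :=
  Seq (Block [LOAD (Reg 20); STORE 4; LOAD (Reg 21); STORE 5; LOAD (Const 20); STORE 2])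
    (While TPos scanning
      (Seq fetch
        (Seq (Block [LOAD (Reg 12)])
          (If TNeg (Block [LOAD (Reg 6); STORE 4; LOAD (Reg 7); STORE 5])
            (If TZero
              (Seq (Block [LOAD (Reg 11)])
                (If TNeg (Block [LOAD (Reg 6); STORE 4]) skip))
              skip))))).

Definition find_right : com :=
  Seq (Block [LOAD (Const 1); STORE 8; LOAD (Const 20); STORE 2])
    (While TPos scanning (Seq fetch (mark (Const 1) (Const 0) 8 0))).

(** The piece at [b] consists of the cells at [(0, 0)], [(0, 1)], [(1, g)] and
    [(2 g - 1, g + 1)] relative to [b], where [g] is the content of register 8. *)
Definition remove_piece : com :=
  Seq (Block [LOAD (Reg 8); ADD (Reg 8); SUB (Const 1); STORE 9;
              LOAD (Reg 8); ADD (Const 1); STORE 10;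
              LOAD (Const 20); STORE 2; STORE 3])
    (While TPos scanning
      (Seq fetch
        (Seq (Block [LOAD (Const 1); STORE 13])
          (Seq (mark (Const 0) (Const 0) 13 0)
            (Seq (mark (Const 0) (Const 1) 13 0)
              (Seq (mark (Const 1) (Reg 8) 13 0)
                (Seq (mark (Reg 9) (Reg 10) 13 0)
                  (Seq (Block [LOAD (Reg 13)])
                    (If TPos
                      (Seq (Block [LOAD (Reg 6)]) (Seq (push 3)
                        (Seq (Block [LOAD (Reg 7)]) (push 3))))
                      skip))))))))).

(** An incomplete piece is reported by the address 19 in register 1, which also
    stops the main loop. *)
Definition check_removed : com :=
  Seq (Block [LOAD (Reg 1); SUB (Reg 3); SUB (Const 8)])
    (If TZero (Block [LOAD (Reg 3); STORE 1]) (Block [LOAD (Const 19); STORE 1])).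

Definition cover_least : com :=
  Seq find_least (Seq find_right (Seq remove_piece check_removed)).

Definition cover_all : com :=
  While TPos (Block [LOAD (Reg 1); SUB (Const 20)]) cover_least.

(** Register 1 ends at 20 (empty array) on success and at 19 on failure, so subtracting 19 gives the
    answer 1 or 0. *)
Definition solver (mir : bool) : com :=
  Seq (load_input mir) (Seq cover_all (Block [LOAD (Reg 1); SUB (Const 19)])).

(** * Correctness of the program *)

Lemma upd_far m k z j : 20 <= k -> j < 20 -> upd m k z j = m j.
Proof. intros Hk Hj. unfold upd. destruct (Nat.eqb_spec j k); [lia|reflexivity]. Qed.

Lemma upd_other m k z j : j <> k -> upd m k z j = m j.
Proof. intros H. unfold upd. now rewrite (proj2 (Nat.eqb_neq j k) H). Qed.

Definition fetch_registers : list nat := [0; 2; 6; 7; 11; 12].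

Lemma wp_fetch input (Q : memory -> Prop) (m : memory) a c :
  m 2 = Z.of_nat a -> 20 <= a -> m a = fst c -> m (S a) = snd c ->
  (forall m' : memory, m' 2 = Z.of_nat (S (S a)) -> m' 6 = fst c -> m' 7 = snd c ->
     m' 11 = (fst c - m 4%nat)%Z -> m' 12 = (snd c - m 5%nat)%Z ->
     (forall k, ~ In k fetch_registers -> m' k = m k) -> Q m') ->
  wp input fetch Q m.
Proof.
  intros H2 Ha Hx Hy HQ. split; [reflexivity|].
  assert (E1 : Z.to_nat (m 2%nat) = a) by lia.
  assert (E2 : Z.to_nat (m 2%nat + 1) = S a) by lia.
  cbn [fetch advance app fold_left effect step snd eval].
  match goal with |- Q ?M => set (m' := M) end.
  apply HQ; subst m'; cbn; try lia.
  - now rewrite E1.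
  - now rewrite E2, !upd_other by lia.
  - now rewrite E1, Hx.
  - now rewrite E2, !upd_other, Hy by lia.
  - intros k Hk. rewrite !upd_other; auto; intros ->; apply Hk; tauto.
Qed.

(** [mark] overwrites the accumulator before it evaluates its operands. The test is conservative: an
    indirect operand might lead to register 0, so it is rejected. *)
Definition reads_acc (x : operand) : bool :=
  match x with Const _ => false | Reg j => Nat.eqb j 0 | Ind _ => true end.

Lemma eval_acc_free (m m' : memory) x : reads_acc x = false ->
  (forall k, k <> 0 -> m' k = m k) -> eval m' x = eval m x.
Proof. destruct x as [z|[|j]|j]; cbn; try discriminate; auto. Qed.

Lemma wp_mark input (Q : memory -> Prop) (m : memory) x y j z :
  reads_acc x = false -> reads_acc y = false -> j <> 0 ->
  (forall m' : memory,
     m' j = (if Z.eqb (m 11) (eval m x) && Z.eqb (m 12) (eval m y) then z else m j) ->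
     (forall k, k <> 0 -> k <> j -> m' k = m k) -> Q m') ->
  wp input (mark x y j z) Q m.
Proof.
  intros Hx Hy Hj HQ. split; [reflexivity|].
  cbn [fold_left effect step snd eval]. change (upd ?m 0 ?z 0) with z.
  rewrite (eval_acc_free m) by (trivial; intros k Hk; now rewrite upd_other).
  set (m1 := upd _ _ _).
  assert (F1 : forall k, k <> 0 -> m1 k = m k)
    by (intros k Hk; unfold m1; now rewrite !upd_other).
  cbn [wp]. change (passes TZero (m1 0)) with (Z.eqb (m 11 - eval m x) 0).
  destruct (Z.eqb_spec (m 11) (eval m x)) as [E|E].
  2:{ rewrite (proj2 (Z.eqb_neq _ 0)) by lia. split; [reflexivity|].
      apply HQ; [now apply F1 | now intros k Hk _; apply F1]. }
  rewrite (proj2 (Z.eqb_eq _ 0)) by lia. split; [reflexivity|].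
  cbn [fold_left effect step snd eval]. change (upd ?m 0 ?z 0) with z.
  rewrite (eval_acc_free m) by
    (trivial; intros k Hk; rewrite upd_other by assumption; now apply F1).
  rewrite F1 by discriminate. 
  set (m2 := upd (upd m1 0 (m 12)) 0 (m 12%nat - eval m y)%Z).
  assert (F2 : forall k, k <> 0 -> m2 k = m k).
  { intros k Hk; unfold m2; rewrite !upd_other by assumption. now apply F1. }
  change (passes TZero _) with (Z.eqb (m 12%nat - eval m y) 0).
  cbn [andb] in HQ.
  destruct (Z.eqb_spec (m 12) (eval m y)) as [E'|E'].
  - rewrite (proj2 (Z.eqb_eq _ 0)) by lia. split; [reflexivity|].
    cbn [fold_left effect step snd eval]. change (upd ?m 0 ?z 0) with z.
    apply HQ.
    + unfold upd. now rewrite Nat.eqb_refl.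
    + intros k Hk Hkj. rewrite !upd_other by assumption. now apply F2.
  - rewrite (proj2 (Z.eqb_neq _ 0)) by lia. split; [reflexivity|].
    apply HQ; [now apply F2 | now intros k Hk _; apply F2].
Qed.

Definition stored (L : list cell) (m : memory) : Prop :=
  m 1 = Z.of_nat (20 + 2 * length L) /\ cells_at m 20 L.

Lemma wp_push input (Q : memory -> Prop) (m : memory) j a :
  m j = Z.of_nat a -> 20 <= a -> 0 < j < 20 ->
  (forall m' : memory, m' a = m 0 -> m' j = Z.of_nat (S a) ->
     (forall k, k <> 0 -> k <> j -> k <> a -> m' k = m k) -> Q m') ->
  wp input (push j) Q m.
Proof.
  intros Hj Ha H20 HQ. split; [reflexivity|].
  cbn [push advance fold_left effect step snd eval].
  rewrite Hj, Nat2Z.id, (upd_far m a) by lia. change (upd ?m 0 ?z 0) with z.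
  apply HQ.
  - rewrite !upd_other by lia. unfold upd. now rewrite Nat.eqb_refl.
  - unfold upd at 1. rewrite Nat.eqb_refl, Hj. cbn [upd Nat.eqb]. lia.
  - intros k H0 H1 H2. now rewrite !upd_other by assumption.
Qed.

Ltac run_block m :=
  split; [reflexivity|];
  match goal with |- context [fold_left (effect ?i) ?l ?u] =>
    set (m := fold_left (effect i) l u) end.

Ltac unaffected :=
  intros; match goal with |- ?m _ = _ => subst m end;
  cbn [app advance fold_left effect step snd]; rewrite !upd_other by assumption; auto.

Lemma load_input_achieves mir A input :
  nth 0 input 0%Z = Z.of_nat (length A) ->
  cells_at (fun i => nth i input 0%Z) 1 A ->
  achieves input (load_input mir) (fun _ => 0%Z) (40 * (length A + 1))
    (stored (map (flip mir) A)).
Proof.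
  intros Hn Hin. unfold load_input.
  set (I := fun (d r : list cell) (m : memory) =>
    stored (map (flip mir) d) m /\ m 3 = Z.of_nat (length r) /\
    exists j, m 2 = Z.of_nat j /\ cells_at (fun i => nth i input 0%Z) j r).
  eapply achieves_weaken with (Q := I A []).
  - eapply achieves_seq with (Q1 := I [] A).
    + apply wp_achieves. split; [reflexivity|].
      cbn [fold_left effect step snd eval]. unfold I, stored. cbn.
      (* Reading starts at input position 1, just after the number of cells. *)
      repeat split; auto. now exists 1.
    + intros m1 H1. apply (achieves_scan _ _ _ _ I); [| |exact H1]; clear m1 H1.
      * intros d c r m ((E1 & H2) & H3 & j & Hj & Hx & Hy & Hr).
        rewrite length_map in E1.
        run_block m0. split.
        { change (m0 0) with (m 3). rewrite H3. reflexivity. }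
        assert (F0 : forall k, k <> 0 -> m0 k = m k) by unaffected.
        clearbody m0.
        split; [now destruct mir|].
        match goal with |- context [fold_left (effect ?i) ?l ?u] =>
          set (m1 := fold_left (effect i) l u) end.
        assert (V1 : m1 0 = fst (flip mir c)).
        { subst m1. destruct mir; cbn; rewrite F0, Hj, Nat2Z.id, Hx by lia; lia. }
        assert (F1 : forall k, k <> 0 -> k <> 4 -> m1 k = m k).
        { destruct mir; unaffected. }
        clearbody m1.
        apply (wp_push _ _ _ _ (20 + 2 * length d)); [rewrite F1 by lia; exact E1 | lia | lia |].
        intros m2 V2 P2 F2. run_block m3.
        assert (V3 : m3 0 = snd c).
        { change (m3 0) with (nth (Z.to_nat (m2 2%nat + 1)) input 0%Z).
          rewrite F2, F1, Hj, <- Hy by lia. f_equal. lia. }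
        assert (P3 : m3 2 = Z.of_nat (S j)).
        { change (m3 2) with (m2 2%nat + 1)%Z. rewrite F2, F1, Hj by lia. lia. }
        assert (F3 : forall k, k <> 0 -> k <> 2 -> m3 k = m2 k) by unaffected.
        clearbody m3.
        apply (wp_push _ _ _ _ (S (20 + 2 * length d)));
          [now rewrite F3 | lia | lia |].
        intros m4 V4 P4 F4. run_block m5.
        assert (F5 : forall k, k <> 0 -> k <> 2 -> k <> 3 -> m5 k = m4 k) by unaffected.
        assert (P5 : m5 2 = Z.of_nat (S (S j))).
        { change (m5 2) with (m4 2%nat + 1)%Z. rewrite F4, P3 by lia. lia. }
        assert (N5 : m5 3 = Z.of_nat (length r)).
        { change (m5 3) with (m4 3%nat - 1)%Z. rewrite F4, F3, F2, F1, H3 by lia.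
          cbn [length]. lia. }
        clearbody m5. unfold I, stored.
        rewrite map_app, length_app, length_map. repeat split; auto.
        { rewrite F5, P4 by lia. f_equal. cbn. lia. }
        { apply cells_at_app. rewrite length_map. split; [|repeat split].
          - revert H2. apply cells_at_ext. rewrite length_map. intros k Hk.
            now rewrite F5, F4, F3, F2, F1 by lia.
          - now rewrite F5, F4, F3, V2 by lia.
          - rewrite F5, V4, V3 by lia. now destruct mir. }
        { exists (S (S j)). split; assumption. }
      * intros d m (H1 & H2 & j & H3 & H4). run_block m0.
        change (m0 0) with (m 3). rewrite H2. split; [reflexivity|].
        assert (F0 : forall k, k <> 0 -> m0 k = m k) by unaffected.
        clearbody m0. unfold I, stored. rewrite !F0 by lia.
        split; [split; [apply H1|] | split; [assumption | now exists j]].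
        destruct H1 as [_ H1]. revert H1. apply cells_at_ext. intros k Hk.
        apply F0. lia.
  - destruct mir; cbn; lia.
  - now intros m' [H _].
Qed.

(** [d] is the scanned part of the list of cells and [r] the remaining part. *)
Definition at_cells (d r : list cell) (m : memory) : Prop :=
  m 1 = Z.of_nat (20 + 2 * (length d + length r)) /\
  m 2 = Z.of_nat (20 + 2 * length d) /\
  cells_at m (20 + 2 * length d) r.

(** The body already sees [c] among the scanned cells because [fetch] has advanced the pointer; [J]
    must therefore survive any change to [fetch_registers]. The constant 20 is 2 for the guard, 16
    for [fetch] and 2 for the jumps of a round. *)
Lemma achieves_cell_scan input body (J : list cell -> memory -> Prop) L :
  (forall d m m', J d m -> (forall k, ~ In k fetch_registers -> m' k = m k) -> J d m') ->
  (forall d c r m, L = d ++ c :: r -> at_cells (d ++ [c]) r m -> J d m ->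
     m 6 = fst c -> m 7 = snd c -> m 11 = (fst c - m 4%nat)%Z ->
     m 12 = (snd c - m 5%nat)%Z ->
     wp input body (fun m' => at_cells (d ++ [c]) r m' /\ J (d ++ [c]) m') m) ->
  forall m, at_cells [] L m -> J [] m ->
  achieves input (While TPos scanning (Seq fetch body)) m
    ((cost body + 20) * (length L + 1))
    (fun m' => m' 1 = Z.of_nat (20 + 2 * length L) /\ J L m').
Proof.
  intros Hst Hstep m HL HJ.
  set (I := fun (d r : list cell) (m : memory) => L = d ++ r /\ at_cells d r m /\ J d m).
  apply achieves_weaken with (T := (cost scanning + cost (Seq fetch body) + 2) * (length L + 1))
    (Q := I L []).
  2:{ cbn [scanning fetch cost app advance length]. lia. }
  2:{ intros m' (_ & (H1 & _ & _) & HJ'). split; [|assumption].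
      rewrite H1. cbn [length]. f_equal. lia. }
  apply achieves_scan; [| |now repeat split; try apply HL]; clear m HL HJ.
  - intros d c r m (HL & (H1 & H2 & Hx & Hy & Hr) & HJ). run_block m0.
    assert (V0 : m0 0 = (m 1%nat - m 2%nat)%Z) by reflexivity.
    assert (F0 : forall k, k <> 0 -> m0 k = m k) by unaffected.
    clearbody m0. split.
    { apply Z.ltb_lt. rewrite V0, H1, H2. cbn [length]. lia. }
    apply (wp_fetch _ _ _ (20 + 2 * length d) c).
    + now rewrite F0.
    + lia.
    + now rewrite F0 by lia.
    + now rewrite F0 by lia.
    + intros m1 P1 X1 Y1 DX DY F1. eapply wp_mono.
      2:{ apply (Hstep d c r); auto.
          - unfold at_cells. rewrite length_app. cbn [length].
            rewrite F1, F0, H1, P1 by (cbn; lia). repeat split.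
            + f_equal. cbn [length]. lia.
            + f_equal. lia.
            + replace (20 + 2 * (length d + 1)) with (S (S (20 + 2 * length d))) by lia.
              revert Hr. apply cells_at_ext. intros k Hk.
              now rewrite F1, F0 by (cbn; lia).
          - apply (Hst d m); [assumption|]. intros k Hk.
            assert (k <> 0) by (intros ->; apply Hk; now left).
            now rewrite F1, F0.
          - now rewrite (F1 4) by (cbn; lia).
          - now rewrite (F1 5) by (cbn; lia). }
      intros m' [Hm1 Hm2]. repeat split; try apply Hm1; auto.
      now rewrite HL, <- app_assoc.
  - intros d m (HL & (H1 & H2 & Hr) & HJ). run_block m0.
    assert (V0 : m0 0 = (m 1%nat - m 2%nat)%Z) by reflexivity.
    assert (F0 : forall k, k <> 0 -> m0 k = m k) by unaffected.
    clearbody m0. cbn [length] in H1.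
    split; [apply Z.ltb_ge; rewrite V0, H1, H2; lia|].
    split; [assumption|]. split.
    + unfold at_cells. rewrite !F0, H1, H2 by lia. repeat split.
    + apply (Hst d m); [assumption|]. intros k Hk. apply F0.
      intros ->. apply Hk. now left.
Qed.

Lemma cells_at_fetch (m m' : memory) L :
  (forall k, ~ In k fetch_registers -> m' k = m k) ->
  cells_at m 20 L -> cells_at m' 20 L.
Proof. intros H. apply cells_at_ext. intros k Hk. apply H. cbn. lia. Qed.

Lemma at_cells_ext (m m' : memory) d r :
  (forall k, k = 1 \/ k = 2 \/ 20 <= k -> m' k = m k) -> at_cells d r m -> at_cells d r m'.
Proof.
  intros H (H1 & H2 & H3). unfold at_cells. rewrite !H by lia. repeat split; auto.
  revert H3. apply cells_at_ext. intros k Hk. apply H. lia.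
Qed.

(** * The stages of one greedy round *)

Lemma find_least_achieves input L m : L <> [] -> stored L m ->
  achieves input find_least m (40 * (length L + 1))
    (fun m' => stored L m' /\ In (m' 4, m' 5) L /\
               forall c, In c L -> lex_le (m' 4, m' 5) c).
Proof.
  intros Hne [HE HL]. destruct L as [|a L0] eqn:EL; [congruence|]. rewrite <- EL in *.
  assert (Ha : m 20 = fst a /\ m 21 = snd a) by (rewrite EL in HL; split; apply HL).
  set (J := fun (d : list cell) (m : memory) =>
    cells_at m 20 L /\ In (m 4, m 5) L /\ forall c, In c d -> lex_le (m 4, m 5) c).
  eapply achieves_weaken.
  - eapply achieves_seq with (Q1 := fun m1 => at_cells [] L m1 /\ J [] m1).
    + apply wp_achieves. run_block m1.
      assert (F1 : forall k, k <> 0 -> k <> 2 -> k <> 4 -> k <> 5 -> m1 k = m k)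
        by unaffected.
      assert (V1 : m1 2 = 20%Z /\ m1 4 = fst a /\ m1 5 = snd a) by (cbn; tauto).
      clearbody m1. destruct V1 as (V1 & V2 & V3).
      assert (HL1 : cells_at m1 20 L).
      { revert HL. apply cells_at_ext. intros k Hk. apply F1; lia. }
      split.
      * split; [now rewrite F1, HE by lia | now split].
      * split; [assumption|]. rewrite V2, V3, EL. split; [|intros c []].
        left. now destruct a.
    + intros m1 [A1 J1]. apply (achieves_cell_scan _ _ J L); auto.
      * intros d m2 m3 (H1 & H2 & H3) F. unfold J. rewrite !F by (cbn; lia).
        split; [now apply (cells_at_fetch m2) | now split].
      * clear m m1 HE HL Ha A1 J1.
        intros d c r m EQ HA (H1 & H2 & H3) X Y DX DY.
        assert (Hc : In c L) by (rewrite EQ; apply in_or_app; now right; left).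
        (* Every path through the body either keeps the current minimum or replaces it by [c];
           [Hkeep] and [Hset] restore the invariant in these two cases. *)
        assert (Hkeep : forall m' : memory, (forall k, k <> 0 -> m' k = m k) ->
          lex_le (m 4, m 5) c -> at_cells (d ++ [c]) r m' /\ J (d ++ [c]) m').
        { intros m' F Hle. split.
          - revert HA. apply at_cells_ext. intros k Hk. apply F. lia.
          - unfold J. rewrite !F by lia. split; [|split; [assumption|]].
            + revert H1. apply cells_at_ext. intros k Hk. apply F. lia.
            + intros e He. apply in_app_or in He as [He|[<-|[]]]; auto. }
        assert (Hset : forall m' : memory,
          (forall k, k <> 0 -> k <> 4 -> k <> 5 -> m' k = m k) ->
          m' 4 = fst c -> m' 5 = snd c -> lex_le c (m 4, m 5) ->
          at_cells (d ++ [c]) r m' /\ J (d ++ [c]) m').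
        { intros m' F E4 E5 Hle. split.
          - revert HA. apply at_cells_ext. intros k Hk. apply F; lia.
          - unfold J. rewrite E4, E5, <- surjective_pairing.
            split; [|split; [assumption|]].
            + revert H1. apply cells_at_ext. intros k Hk. apply F; lia.
            + intros e He. apply in_app_or in He as [He|[<-|[]]].
              * specialize (H3 e He). unfold lex_le in *. cbn in *. lia.
              * unfold lex_le. lia. }
        run_block m1.
        assert (F1 : forall k, k <> 0 -> m1 k = m k) by unaffected.
        assert (V1 : m1 0 = m 12) by reflexivity.
        clearbody m1. cbn [wp passes]. rewrite V1, DY.
        destruct (Z.ltb_spec (snd c - m 5%nat) 0) as [Hlt|Hge].
        { split; [reflexivity|]. apply Hset.
          - intros k K0 K4 K5. cbn [fold_left effect step snd].
            rewrite !upd_other by assumption. now apply F1.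
          - cbn. now rewrite F1.
          - cbn. now rewrite F1.
          - unfold lex_le. cbn. lia. }
        destruct (Z.eqb_spec (snd c - m 5%nat) 0) as [Heq|Hgt].
        2:{ split; [reflexivity|]. apply Hkeep; [assumption|]. unfold lex_le. cbn. lia. }
        run_block m2.
        assert (F2 : forall k, k <> 0 -> m2 k = m k).
        { intros k Hk. rewrite <- F1 by assumption. revert k Hk. unaffected. }
        assert (V2 : m2 0 = m1 11) by reflexivity.
        rewrite V2, F1, DX by lia. clearbody m2.
        destruct (Z.ltb_spec (fst c - m 4%nat) 0) as [Hlt|Hge2].
        { split; [reflexivity|]. apply Hset.
          - intros k K0 K4 K5. cbn [fold_left effect step snd].
            rewrite !upd_other by assumption. now apply F2.
          - cbn. now rewrite F2.
          - cbn. rewrite F2 by lia. lia.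
          - unfold lex_le. cbn. lia. }
        split; [reflexivity|]. apply Hkeep; [assumption|]. unfold lex_le. cbn. lia.
  - cbn -[Nat.mul]. lia.
  - intros m' [H1 (H2 & H3 & H4)]. repeat split; auto.
Qed.

Lemma find_right_achieves input L b m :
  stored L m -> (m 4, m 5) = b ->
  achieves input find_right m (40 * (length L + 1))
    (fun m' => stored L m' /\ (m' 4, m' 5) = b /\
               m' 8 = if in_dec cell_eq_dec (right_of b) L then 0%Z else 1%Z).
Proof.
  intros [HE HL] Hb.
  set (J := fun (d : list cell) (m : memory) =>
    cells_at m 20 L /\ (m 4, m 5) = b /\
    m 8 = if in_dec cell_eq_dec (right_of b) d then 0%Z else 1%Z).
  eapply achieves_weaken.
  - eapply achieves_seq with (Q1 := fun m1 => at_cells [] L m1 /\ J [] m1).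
    + apply wp_achieves. run_block m1.
      assert (F1 : forall k, k <> 0 -> k <> 2 -> k <> 8 -> m1 k = m k) by unaffected.
      assert (V1 : m1 2 = 20%Z /\ m1 8 = 1%Z) by (cbn; tauto).
      clearbody m1. destruct V1 as (V1 & V2).
      assert (HL1 : cells_at m1 20 L).
      { revert HL. apply cells_at_ext. intros k Hk. apply F1; lia. }
      split.
      * split; [now rewrite F1, HE by lia | now split].
      * split; [assumption|]. rewrite !F1 by lia. now split.
    + intros m1 [A1 J1]. apply (achieves_cell_scan _ _ J L); auto.
      * intros d m2 m3 (H1 & H2 & H3) F. unfold J. rewrite !F by (cbn; lia).
        split; [now apply (cells_at_fetch m2) | now split].
      * clear m m1 HE HL Hb A1 J1.
        intros d c r m EQ HA (H1 & H2 & H3) X Y DX DY.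
        apply wp_mark; [reflexivity | reflexivity | discriminate |].
        intros m' V F. cbn [eval] in V. split.
        { revert HA. apply at_cells_ext. intros k Hk. apply F; lia. }
        split; [|split].
        -- revert H1. apply cells_at_ext. intros k Hk. apply F; lia.
        -- now rewrite !F by lia.
        -- rewrite V, DX, DY, H3.
           assert (P : In (right_of b) (d ++ [c]) <->
             In (right_of b) d \/ (fst c - m 4%nat = 1 /\ snd c - m 5%nat = 0)%Z).
           { rewrite in_app_iff, <- H2. unfold right_of. destruct c as [cx cy]. cbn.
             split; (intros [H|H]; [now left | right]).
             - destruct H as [H|[]]. injection H. lia.
             - left. f_equal; lia. }
           destruct (in_dec _ _ (d ++ [c])) as [i|n], (in_dec _ _ d) as [i'|n'];
             destruct (Z.eqb_spec (fst c - m 4%nat) 1), (Z.eqb_spec (snd c - m 5%nat) 0);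
             cbn [andb]; trivial; tauto.
  - cbn -[Nat.mul]. lia.
  - intros m' [H1 (H2 & H3 & H4)]. now repeat split.
Qed.

(** Writing both orientations as one formula in [g] allows the program to test four relative
    positions without branching on the orientation. *)
Lemma in_piece (o : bool) b c : In c (piece o b) <->
  let dx := (fst c - fst b)%Z in let dy := (snd c - snd b)%Z in
  let g := if o then 0%Z else 1%Z in
  (dx = 0 /\ dy = 0 \/ dx = 0 /\ dy = 1 \/ dx = 1 /\ dy = g \/
   dx = g + g - 1 /\ dy = g + 1)%Z.
Proof.
  destruct b as [x y], c as [cx cy], o; cbn; split.
  1,3: intros H; repeat destruct H as [H|H]; try contradiction; injection H; lia.
  - intros [H|[H|[H|H]]];
      [left | right; right; right; left | right; left | right; right; left]; f_equal; lia.
  - intros [H|[H|[H|H]]];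
      [left | right; left | right; right; left | right; right; right; left]; f_equal; lia.
Qed.

Lemma remove_piece_achieves input L b (o : bool) m :
  stored L m -> (m 4, m 5) = b -> m 8 = (if o then 0%Z else 1%Z) ->
  achieves input remove_piece m (120 * (length L + 1))
    (fun m' => m' 1 = Z.of_nat (20 + 2 * length L) /\
               m' 3 = Z.of_nat (20 + 2 * length (filter (outside o b) L)) /\
               cells_at m' 20 (filter (outside o b) L)).
Proof.
  intros [HE HL] Hb Ho. set (g := if o then 0%Z else 1%Z) in Ho.
  set (J := fun (d : list cell) (m : memory) =>
    (m 4, m 5) = b /\ (m 8 = g /\ m 9 = (g + g - 1)%Z /\ m 10 = (g + 1)%Z) /\
    m 3 = Z.of_nat (20 + 2 * length (filter (outside o b) d)) /\
    cells_at m 20 (filter (outside o b) d)).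
  eapply achieves_weaken.
  - eapply achieves_seq with (Q1 := fun m1 => at_cells [] L m1 /\ J [] m1).
    + apply wp_achieves. run_block m1.
      assert (F1 : forall k, k <> 0 -> k <> 2 -> k <> 3 -> k <> 9 -> k <> 10 ->
        m1 k = m k) by unaffected.
      assert (V1 : m1 2 = 20%Z /\ m1 3 = 20%Z /\ m1 9 = (m 8%nat + m 8%nat - 1)%Z
        /\ m1 10 = (m 8%nat + 1)%Z) by (cbn; tauto).
      clearbody m1. destruct V1 as (V1 & V2 & V3 & V4).
      split.
      * split; [now rewrite F1, HE by lia | split; [assumption|]].
        revert HL. apply cells_at_ext. intros k Hk. apply F1; lia.
      * unfold J. rewrite V3, V4, !F1, Ho by lia. now repeat split.
    + intros m1 [A1 J1]. apply (achieves_cell_scan _ _ J L); auto.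
      * intros d m2 m3 (H1 & (H2 & H3 & H4) & H5 & H6) F. unfold J.
        rewrite !F by (cbn; lia). repeat split; auto. now apply (cells_at_fetch m2).
      * clear m m1 HE HL Hb Ho A1 J1.
        intros d c r m EQ HA (H1 & (H2 & H3 & H4) & H5 & H6) X Y DX DY.
        (* The array is compacted in place: no more cells are kept than scanned, so the write
           pointer never reaches the unread cells. *)
        assert (HK : length (filter (outside o b) d) <= length d) by apply filter_length_le.
        run_block m0.
        assert (F0 : forall k, k <> 0 -> k <> 13 -> m0 k = m k) by unaffected.
        assert (V0 : m0 13 = 1%Z) by reflexivity.
        clearbody m0.
        apply wp_mark; [reflexivity | reflexivity | discriminate |].
        intros m1 V1 F1. cbn [eval] in V1. rewrite V0, !F0 in V1 by lia.
        apply wp_mark; [reflexivity | reflexivity | discriminate |].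
        intros m2 V2 F2. cbn [eval] in V2. rewrite V1, !F1, !F0 in V2 by lia.
        apply wp_mark; [reflexivity | reflexivity | discriminate |].
        intros m3 V3 F3. cbn [eval] in V3. rewrite V2, !F2, !F1, !F0 in V3 by lia.
        apply wp_mark; [reflexivity | reflexivity | discriminate |].
        intros m4 V4 F4. cbn [eval] in V4. rewrite V3, !F3, !F2, !F1, !F0 in V4 by lia.
        assert (F : forall k, k <> 0 -> k <> 13 -> m4 k = m k)
          by (intros k K1 K2; now rewrite F4, F3, F2, F1, F0).
        (* The flag in register 13 stays 1 exactly if none of the four marks matched [c]. *)
        assert (V : m4 13 = if outside o b c then 1%Z else 0%Z).
        { rewrite V4. clear - H1 H2 H3 H4 DX DY. unfold outside.
          pose proof (in_piece o b c) as P. subst b. cbn [fst snd] in P.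
          rewrite <- DX, <- DY in P. fold g in P. cbv zeta in P.
          rewrite H2, H3, H4.
          destruct in_dec as [i|n].
          - apply P in i.
            repeat match goal with |- context [Z.eqb ?u ?v] =>
              destruct (Z.eqb_spec u v) end; cbn [andb]; trivial; lia.
          - assert (P' := fun H => n (proj2 P H)). clear P n.
            repeat match goal with |- context [Z.eqb ?u ?v] =>
              destruct (Z.eqb_spec u v) end; cbn [andb]; trivial; exfalso; lia. }
        clear m0 m1 m2 m3 F0 F1 F2 F3 F4 V0 V1 V2 V3 V4.
        run_block m5.
        assert (F5 : forall k, k <> 0 -> k <> 13 -> m5 k = m k).
        { intros k K1 K2. rewrite <- F by assumption. revert k K1 K2. unaffected. }
        assert (V5 : m5 0 = m4 13) by reflexivity.
        clearbody m5. cbn [wp passes]. rewrite V5, V.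
        unfold J. rewrite filter_app. cbn [filter].
        destruct (outside o b c); cbn [Z.ltb Z.compare].
        2:{ split; [reflexivity|]. cbn [fold_left]. rewrite app_nil_r. split.
            - revert HA. apply at_cells_ext. intros k Hk. apply F5; lia.
            - rewrite !F5 by lia. repeat split; auto.
              revert H6. apply cells_at_ext. intros k Hk. apply F5; lia. }
        set (K := filter (outside o b) d) in *.
        run_block m6.
        assert (F6 : forall k, k <> 0 -> k <> 13 -> m6 k = m k).
        { intros k K1 K2. rewrite <- F5 by assumption. revert k K1 K2. unaffected. }
        assert (V6 : m6 0 = fst c) by (rewrite <- X, <- F5 by lia; reflexivity).
        clearbody m6.
        apply (wp_push input _ m6 3 (20 + 2 * length K)); [rewrite F6 by lia; exact H5 | lia | lia |].
        intros m7 V7 P7 F7. run_block m8.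
        assert (F8 : forall k, k <> 0 -> m8 k = m7 k) by unaffected.
        assert (V8 : m8 0 = snd c).
        { rewrite <- Y, <- F6, <- F7 by lia. reflexivity. }
        clearbody m8.
        apply (wp_push input _ m8 3 (S (20 + 2 * length K))); [rewrite F8 by lia; exact P7 | lia | lia |].
        intros m9 V9 P9 F9.
        assert (F' : forall k, k <> 0 -> k <> 3 -> k <> 13 -> k <> 20 + 2 * length K ->
          k <> S (20 + 2 * length K) -> m9 k = m k).
        { intros. now rewrite F9, F8, F7, F6. }
        assert (HA' := HA). destruct HA' as (A1 & A2 & A3).
        rewrite length_app in A1, A2, A3. cbn [length] in A1, A2, A3.
        split; [|split; [|split; [|split]]].
        -- split; [|split]; rewrite ?length_app; cbn [length].
           ++ now rewrite F' by lia.
           ++ now rewrite F' by lia.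
           ++ revert A3. apply cells_at_ext. intros k Hk. apply F'; lia.
        -- now rewrite !F' by lia.
        -- rewrite !F' by lia. auto.
        -- rewrite P9, length_app. cbn [length]. f_equal. lia.
        -- apply cells_at_app. split; [|split; [|split; [|exact Logic.I]]].
           ++ revert H6. apply cells_at_ext. intros k Hk. apply F'; lia.
           ++ now rewrite F9, F8, V7, V6 by lia.
           ++ now rewrite V9, V8.
  - cbn -[Nat.mul]. lia.
  - intros m' [H1 (_ & _ & H2 & H3)]. exact (conj H1 (conj H2 H3)).
Qed.

(** * The main loop and the polynomial bound *)

Definition decided (L : list cell) (m : memory) : Prop :=
  (m 1 = 20%Z /\ packable L) \/ (m 1 = 19%Z /\ ~ packable L).

(** The program compares addresses: a difference of 8 registers is a difference of four cells, the
    condition in [packable_step]. *)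
Lemma check_removed_achieves input (L L' : list cell) (m : memory) :
  m 1 = Z.of_nat (20 + 2 * length L) -> m 3 = Z.of_nat (20 + 2 * length L') ->
  cells_at m 20 L' ->
  achieves input check_removed m 9
    (fun m' => if length L' + 4 =? length L then stored L' m' else m' 1 = 19%Z).
Proof.
  intros H1 H3 H. eapply achieves_weaken with (T := cost check_removed);
    [|cbn; lia|intros m' H'; exact H'].
  apply wp_achieves. run_block m0.
  assert (F0 : forall k, k <> 0 -> m0 k = m k) by unaffected.
  assert (V0 : m0 0 = (m 1%nat - m 3%nat - 8)%Z) by reflexivity.
  clearbody m0. cbn [wp passes]. rewrite V0, H1, H3.
  destruct (Nat.eqb_spec (length L' + 4) (length L)) as [E|E].
  - rewrite (proj2 (Z.eqb_eq _ 0)) by lia. run_block m2.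
    assert (F2 : forall k, k <> 0 -> k <> 1 -> m2 k = m0 k) by unaffected.
    assert (V2 : m2 1 = m0 3) by reflexivity. clearbody m2.
    split; [rewrite V2, F0 by lia; exact H3|].
    revert H. apply cells_at_ext. intros k Hk. now rewrite F2, F0 by lia.
  - rewrite (proj2 (Z.eqb_neq _ 0)) by lia. split; reflexivity.
Qed.

(** The factor 209 is 40 + 40 + 120 for the three scans plus 9 for the check, absorbed since
    [length L + 1] is at least 1. *)
Lemma cover_least_achieves input L m : L <> [] -> NoDup L -> stored L m ->
  achieves input cover_least m (209 * (length L + 1))
    (fun m' => (exists L', stored L' m' /\ length L' < length L /\ NoDup L' /\
                           (packable L <-> packable L')) \/
               (m' 1 = 19%Z /\ ~ packable L)).
Proof.
  intros Hne HN HS.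
  set (n := length L + 1).
  eapply achieves_weaken with (T := 40 * n + (40 * n + (120 * n + 9)));
    [|lia|intros m' H'; exact H'].
  eapply achieves_seq; [apply find_least_achieves; eauto|].
  cbn beta. intros m1 (S1 & Hb & Hmin). set (b := (m1 4, m1 5)) in *.
  eapply achieves_seq; [apply (find_right_achieves input L b); [exact S1 | reflexivity]|].
  cbn beta. intros m2 (S2 & B2 & G2).
  set (o := if in_dec cell_eq_dec (right_of b) L then true else false).
  assert (Ho : o = true <-> In (right_of b) L).
  { subst o. destruct in_dec; intuition discriminate. }
  eapply achieves_seq; [apply (remove_piece_achieves input L b o); [exact S2 | exact B2 |]|].
  { rewrite G2. subst o. now destruct in_dec. }
  cbn beta. intros m3 (H1 & H3 & H).
  pose proof (packable_step L b o HN Hb Hmin Ho) as HP.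
  eapply achieves_weaken; [exact (check_removed_achieves _ _ _ _ H1 H3 H) | trivial |].
  intros m' Hm. destruct (Nat.eqb_spec (length (filter (outside o b) L) + 4) (length L)).
  - left. exists (filter (outside o b) L). split; [exact Hm|]. split; [lia|].
    split; [now apply NoDup_filter | tauto].
  - right. split; [exact Hm | tauto].
Qed.

Lemma cover_all_stops input (m : memory) : (m 1%nat <= 20)%Z ->
  exec input cover_all m (fold_left (effect input) [LOAD (Reg 1); SUB (Const 20)] m) 4.
Proof.
  intros H. apply (exec_while_false _ _ _ _ _ _ 2); [now constructor|].
  apply Z.ltb_ge. cbn. lia.
Qed.

(** The induction is on a bound [f] for the length because the next list is a filtered one, not a
    tail. Strict shortening lets [f] drop by one, and the growth of the quadratic bound by
    [250 * (2 * f + 3)] pays for the linear cost of a round. *)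
Lemma cover_all_achieves input f : forall L m, length L <= f -> NoDup L -> stored L m ->
  achieves input cover_all m (250 * (f + 1) * (f + 1)) (decided L).
Proof.
  induction f as [|f IH]; intros L m HL HN HS; destruct L as [|c L0] eqn:EL.
  2:{ cbn in HL. lia. }
  1,2: eexists _, 4; split; [apply cover_all_stops; rewrite (proj1 HS); cbn; lia|];
    split; [lia | left; split; [exact (proj1 HS) | now exists []]].
  rewrite <- EL in *.
  assert (Hne : L <> []) by (rewrite EL; discriminate).
  clear EL.
  set (m0 := fold_left (effect input) [LOAD (Reg 1); SUB (Const 20)] m).
  assert (E0 : exec input (Block [LOAD (Reg 1); SUB (Const 20)]) m m0 2) by now constructor.
  assert (F0 : forall k, k <> 0 -> m0 k = m k) by unaffected.
  assert (S0 : stored L m0).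
  { destruct HS as [H1 H2]. split; [rewrite F0 by lia; exact H1|].
    revert H2. apply cells_at_ext. intros k Hk. apply F0. lia. }
  assert (P0 : passes TPos (m0 0) = true).
  { apply Z.ltb_lt. change (m0 0) with (m 1%nat - 20)%Z. rewrite (proj1 HS).
    destruct L; [congruence | cbn [length]; lia]. }
  destruct (cover_least_achieves input L m0 Hne HN S0) as (m1 & n1 & E1 & Hn1 & H1).
  assert (H : achieves input cover_all m1 (250 * (f + 1) * (f + 1) + 4) (decided L)).
  { destruct H1 as [(L' & S1 & Hlen & HN' & HP) | [H1 HP]].
    - eapply achieves_weaken; [apply (IH L'); [lia | exact HN' | exact S1] | lia |].
      intros m'. unfold decided. tauto.
    - eexists _, 4. split; [apply cover_all_stops; rewrite H1; lia|].
      split; [lia|]. right. split; [exact H1 | exact HP]. }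
  destruct H as (m2 & n2 & E2 & Hn2 & H2).
  eexists m2, _. split; [exact (exec_while_true _ _ _ _ _ _ _ _ _ _ _ E0 P0 E1 E2)|].
  split; [nia | assumption].
Qed.

Lemma solver_achieves mir A input : NoDup A ->
  nth 0 input 0%Z = Z.of_nat (length A) ->
  cells_at (fun i => nth i input 0%Z) 1 A ->
  achieves input (solver mir) (fun _ => 0%Z) (300 * ((length A + 1) * (length A + 1)))
    (fun m => (m 0 = 1%Z \/ m 0 = 0%Z) /\ (m 0 = 1%Z <-> tileable (tile_of mir) A)).
Proof.
  intros HN H0 HA. set (n := length A + 1). set (L := map (flip mir) A).
  assert (HL : NoDup L).
  { apply (NoDup_count_occ cell_eq_dec). intros c.
    rewrite <- (flip_involutive mir c). unfold L. rewrite count_occ_flip.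
    now apply NoDup_count_occ. }
  eapply achieves_weaken with (T := 40 * n + (250 * n * n + 2)); [| |intros m' H; exact H].
  - eapply achieves_seq; [apply load_input_achieves; eassumption|].
    cbn beta. intros m1 S1.
    eapply achieves_seq; [apply (cover_all_achieves input (length A) L); auto|].
    { unfold L. now rewrite length_map. }
    intros m2 H2. apply (wp_achieves input (Block [LOAD (Reg 1); SUB (Const 19)])).
    split; [reflexivity|]. rewrite (tileable_packable mir A HN). fold L. cbn.
    destruct H2 as [[-> HP]|[-> HP]]; cbn.
    + split; [now left | now split].
    + split; [now right|]. split; [discriminate | contradiction].
  - unfold n. nia.
Qed.

(** Every integer, 0 included, takes at least one symbol. This turns a bound in the number of cells
    into one in the input size; the magnitude of the coordinates does not affect the step count. *)
Lemma input_size_lower_bound A :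
  length (proj1_sig A) + 1 <= input_size (encode_cells A).
Proof.
  assert (Hb : forall z, 1 <= bit_size z).
  { intros [|p|p]; cbn; [lia | | lia]. destruct p; cbn; lia. }
  unfold input_size, encode_cells. cbn [map list_sum fold_right].
  pose proof (Hb (Z.of_nat (length (proj1_sig A)))).
  assert (H1 : forall L : list cell, length L <= list_sum
    (map bit_size (flat_map (fun c : cell => [fst c; snd c]) L))).
  { induction L as [|c L IH]; cbn; [lia|]. pose proof (Hb (fst c)).
    unfold list_sum in IH. lia. }
  specialize (H1 (proj1_sig A)). unfold list_sum in *. lia.
Qed.

Lemma tiling_problem_polynomial mir :
  solvable_in_polynomial_time (tiling_problem (tile_of mir)).
Proof.
  exists (compile 0 (solver mir) ++ [HALT]), 300, 2. intros A.
  destruct (solver_achieves mir (proj1_sig A) (encode_cells A))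
    as (m & n & E & Hn & Hr & Hy).
  - exact (proj2_sig A).
  - reflexivity.
  - apply (cells_at_input [Z.of_nat (length (proj1_sig A))]).
  - exists (m 0). split; [|split; assumption].
    apply (exec_output_within _ _ _ _ _ E). pose proof (input_size_lower_bound A).
    change (encode _ A) with (encode_cells A).
    set (N := input_size _) in *. cbn [Nat.pow]. rewrite Nat.mul_1_r. nia.
Qed.

Theorem theorem5p4 :
  solvable_in_polynomial_time (tiling_problem S_tetromino) /\
  solvable_in_polynomial_time (tiling_problem Z_tetromino).
Proof.
  split; [exact (tiling_problem_polynomial false) | exact (tiling_problem_polynomial true)].
Qed.
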